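(* If $M$ is a rank-$r$ paving matroid, then $hc(B(M))=r$, where $B(M)$ is the hypergraph whose vertices are the elements of $M$ and whose hyperedges are the bases of $M$.
   Context: A matroid is paving if each of its circuits has size at least the rank of the matroid. A $t$-colouring of a hypergraph $H=(V,E)$ is an onto function from $V$ to the set $[t]=\{1,\dots,t\}$ (that is, all the colours must be used). A $t$-colouring $\phi$ of $H$ is heterochromatic if there is some hyperedge $e\in E$ such that the images of the vertices in $e$ under $\phi$ are all distinct (a totally multicoloured hyperedge). The heterochromatic number $hc(H)$ is the minimum value $t$ for which every $t$-colouring of $H$ is heterochromatic.
   Formalization: The rank r is assumed to be at least 1, and the number of colours t ranges over positive integers; for r = 0 the only basis is the empty set, every colouring is heterochromatic, and hc would be 1 rather than 0. *)

(* Defs.v *)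
From mathcomp Require Import all_boot.

Set Implicit Arguments.
Unset Strict Implicit.
Unset Printing Implicit Defensive.

Section Matroid.

Variable E : finType.

Record matroid := Matroid {
  indep : {set {set E}};
  indep0 : set0 \in indep;
  indepS : forall A B : {set E}, A \subset B -> B \in indep -> A \in indep;
  indep_aug : forall A B : {set E},
    A \in indep -> B \in indep -> #|A| < #|B| ->
    exists2 x, x \in B :\: A & x |: A \in indep
}.

Variable M : matroid.

Definition circuit (C : {set E}) : bool :=
  minset (fun A => A \notin indep M) C.

Definition basis (B : {set E}) : bool :=
  maxset (fun A => A \in indep M) B.

Definition rank : nat := \max_(A in indep M) #|A|.

Definition paving : Prop :=
  forall C : {set E}, circuit C -> rank <= #|C|.

End Matroid.

Section Hypergraph.

Variable V : finType.

Definition hypergraph := {set {set V}}.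

(* The colours 1, ..., t are the elements of 'I_t. *)
Definition colouring (t : nat) (phi : {ffun V -> 'I_t}) : bool :=
  [forall c, c \in codom phi].

Variable H : hypergraph.

Definition heterochromatic (t : nat) (phi : {ffun V -> 'I_t}) : bool :=
  [exists e in H, dinjectiveb phi e].

Definition all_heterochromatic (t : nat) : bool :=
  [forall phi : {ffun V -> 'I_t}, colouring phi ==> heterochromatic phi].

(* There is no colouring with more than #|V| colours. *)
Lemma ex_all_heterochromatic :
  exists t, (0 < t) && all_heterochromatic t.
Proof.
exists #|V|.+1; apply/forallP=> phi; apply/implyP=> /forallP onto_phi.
have : #|'I_(#|V|.+1)| <= #|codom phi|.
  by apply/subset_leq_card/subsetP=> c _; apply: onto_phi.
by rewrite card_ord leqNgt ltnS leq_image_card.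
Qed.

(* The number of colours is positive: since a nonempty vertex set has no      *)
(* map to the empty set of colours, allowing t = 0 would vacuously make the   *)
(* minimum 0 for every hypergraph with a vertex.                              *)
Definition hc : nat := ex_minn ex_all_heterochromatic.

End Hypergraph.

Definition basis_hypergraph (E : finType) (M : matroid E) : hypergraph E :=
  [set B | basis M B].

(* Main.v *)
Require Import Defs.
From mathcomp Require Import all_boot.

Set Implicit Arguments.
Unset Strict Implicit.
Unset Printing Implicit Defensive.

(** Fewer than [r] colours never suffice to make a basis, which has [r]
elements, totally multicoloured; and onto colourings with any smaller positive
number of colours exist because a basis provides [r] vertices. This is the
lower bound ([hc_ge_rank]).

For an onto colouring with [r] colours, choose one vertex of each colour to get
a transversal [T]. In a paving matroid all sets of fewer than [r] elements are
independent ([paving_indep]), so if [T] is dependent then all its subsets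
[T :\ x] span one and the same hyperplane. That hyperplane misses some vertex
[y], because the rank is [r]; exchanging [y] for the element of [T] with the
same colour gives a transversal that spans, hence a multicoloured basis
([paving_all_heterochromatic]). The formal proof replaces spans by two uses of
the augmentation axiom ([paving_exchange]). *)

Section MatroidRank.

Variables (E : finType) (M : matroid E).

Lemma indep_leq_rank (A : {set E}) : A \in indep M -> #|A| <= rank M.
Proof. by move=> iA; apply: leq_bigmax_cond. Qed.

Lemma exists_indep_rank : exists2 A : {set E}, A \in indep M & #|A| = rank M.
Proof.
have indep_gt0 : 0 < #|indep M| by apply/card_gt0P; exists set0; apply: indep0.
have [A iA rankE] := eq_bigmax_cond (fun A : {set E} => #|A|) indep_gt0.
by exists A.
Qed.

Lemma indep_augment_rank (A : {set E}) :
    A \in indep M -> #|A| < rank M ->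
  exists2 x, x \notin A & x |: A \in indep M.
Proof.
move=> iA; have [B iB <-] := exists_indep_rank => ltAB.
have [x /setDP[_ xA] ixA] := indep_aug iA iB ltAB.
by exists x.
Qed.

Lemma indep_rank_basis (A : {set E}) :
  A \in indep M -> #|A| = rank M -> basis M A.
Proof.
move=> iA cA; apply/maxsetP; split=> // B iB sAB.
by apply/esym/eqP; rewrite eqEcard sAB cA indep_leq_rank.
Qed.

Lemma basis_card (B : {set E}) : basis M B -> #|B| = rank M.
Proof.
case/maxsetP=> iB maxB; apply/eqP; rewrite eqn_leq indep_leq_rank //=.
rewrite leqNgt; apply/negP=> ltB.
have [x xB ixB] := indep_augment_rank iB ltB.
by move: xB; rewrite -(maxB _ ixB (subsetUr _ _)) setU11.
Qed.

Lemma rank_leq_card : rank M <= #|E|.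
Proof. by have [A _ <-] := exists_indep_rank; apply: max_card. Qed.

Lemma paving_indep (A : {set E}) :
  paving M -> #|A| < rank M -> A \in indep M.
Proof.
move=> pavM ltA; apply/negPn/negP=> dA.
have [C circC sCA] := @minset_exists _ (fun X => X \notin indep M) A dA.
by have := leq_trans ltA (pavM C circC); rewrite ltnNge subset_leq_card.
Qed.

(** The witness [y] is a point outside the hyperplane spanned by a dependent
[T]. Since every [T :\ x] spans that hyperplane, [y] completes all of them to
bases, whichever [x] is removed; [y] can therefore be chosen before [x]. *)
Lemma paving_exchange (T : {set E}) :
    paving M -> 0 < rank M -> #|T| = rank M -> T \notin indep M ->
  exists y, forall x, x \in T ->
    y |: (T :\ x) \in indep M.
Proof.
move=> pavM rank_gt0 cT dT.
have cTD x : x \in T -> #|T :\ x|.+1 = rank M.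
  by move=> xT; rewrite -cT (cardsD1 x T) xT.
have iTD x : x \in T -> T :\ x \in indep M.
  by move=> xT; apply: paving_indep; rewrite // -(cTD x xT).
have /card_gt0P[x0 x0T] : 0 < #|T| by rewrite cT.
have ltT0 : #|T :\ x0| < rank M by rewrite -(cTD x0 x0T).
have [y yT iS] := indep_augment_rank (iTD _ x0T) ltT0.
exists y => x xT.
have ltS : #|T :\ x| < #|y |: (T :\ x0)|.
  by rewrite cardsU1 yT add1n (cTD x0 x0T) -(cTD x xT).
(* An augmenting element of [T] could only be [x], making [T] independent. *)
have [z /setDP[zS zTx] iz] := indep_aug (iTD _ xT) iS ltS.
case/setU1P: zS => [<- // | /setD1P[_ zT]].
move: zTx; rewrite in_setD1 zT andbT negbK => /eqP zx.
by move: iz; rewrite zx setD1K // (negPf dT).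
Qed.

End MatroidRank.

Section Transversals.

Variables (E : finType) (M : matroid E) (t : nat) (phi : {ffun E -> 'I_t}).

Lemma card_section (g : 'I_t -> E) : cancel g phi -> #|g @: setT| = t.
Proof. by move=> gK; rewrite card_imset ?cardsT ?card_ord //; apply: can_inj gK. Qed.

Lemma indep_section_heterochromatic (g : 'I_t -> E) :
    rank M = t -> cancel g phi -> g @: setT \in indep M ->
  heterochromatic (basis_hypergraph M) phi.
Proof.
move=> rankM gK ig; apply/exists_inP; exists (g @: setT).
  by rewrite inE indep_rank_basis // card_section.
by apply/dinjectiveP=> _ _ /imsetP[c _ ->] /imsetP[d _ ->]; rewrite !gK => ->.
Qed.

Lemma colouring_section : colouring phi -> exists g, cancel g phi.
Proof.
move=> /forallP onto_phi.
by exists (fun c => iinv (onto_phi c)) => c; apply: f_iinv.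
Qed.

End Transversals.

Lemma paving_all_heterochromatic (E : finType) (M : matroid E) :
  0 < rank M -> paving M -> all_heterochromatic (basis_hypergraph M) (rank M).
Proof.
move=> rank_gt0 pavM; apply/forallP=> phi; apply/implyP=> onto_phi.
have [g gK] := colouring_section onto_phi.
have [ig | dg] := boolP (g @: setT \in indep M).
  exact: indep_section_heterochromatic gK ig.
have [y ex_y] := paving_exchange pavM rank_gt0 (card_section gK) dg.
pose h c := if c == phi y then y else g c.
have hK : cancel h phi by move=> c; rewrite /h; case: eqP => [-> | _].
apply: (indep_section_heterochromatic _ hK) => //.
have -> : h @: setT = y |: (g @: setT :\ g (phi y)).
  apply/setP=> z; apply/imsetP/setU1P=> [[c _ ->] | [-> | ]].
  - rewrite /h; case: eqP => [_ | /eqP ne_c]; [by left | right].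
    by rewrite in_setD1 (can_eq gK) ne_c imset_f.
  - by exists (phi y); rewrite // /h eqxx.
  case/setD1P=> ne_z /imsetP[c _ z_c]; exists c => //.
  by move: ne_z; rewrite z_c (can_eq gK) /h => /negPf ->.
by apply: ex_y; rewrite imset_f.
Qed.

Lemma exists_colouring (V : finType) (t : nat) :
  0 < t <= #|V| -> exists phi : {ffun V -> 'I_t}, colouring phi.
Proof.
case: t => // t ltV.
(* Vertices of rank above [t] all get the default colour of [inord]. *)
exists [ffun x => inord (enum_rank x)]; apply/forallP=> c.
apply/codomP; exists (enum_val (widen_ord ltV c)).
by rewrite ffunE enum_valK /= inord_val.
Qed.

Lemma hc_ge_rank (E : finType) (M : matroid E) :
  rank M <= hc (basis_hypergraph M).
Proof.
rewrite /hc; case: ex_minnP => t /andP[t_gt0 /forallP hetM] _.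
rewrite leqNgt; apply/negP=> ltt.
have [|phi onto_phi] := @exists_colouring E t.
  by rewrite t_gt0 (leq_trans (ltnW ltt)) // rank_leq_card.
have /implyP/(_ onto_phi)/exists_inP[B] := hetM phi.
rewrite inE => /basis_card cB /dinjectiveP/card_in_imset cphiB.
by move: ltt; rewrite -cB -cphiB ltnNge -[t in _ <= t]card_ord max_card.
Qed.

Theorem theorem3p2 (E : finType) (M : matroid E) (r : nat)
    (r_gt0 : 0 < r) (rank_M : rank M = r) (paving_M : paving M) :
  hc (basis_hypergraph M) = r.
Proof.
rewrite -rank_M in r_gt0 *; apply/eqP; rewrite eqn_leq hc_ge_rank andbT.
rewrite /hc; case: ex_minnP => t _; apply.
by rewrite r_gt0 paving_all_heterochromatic.
Qed.
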